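(* Let $M=S^2\times S^2\times S^2$ and let $\mathcal{H}=(H,I,J)\colon M\to\mathbb{R}^3$, where $$H(X,Y,Z)=|X+Y+Z|,\qquad I(X,Y,Z)=\langle X+Y+Z,e_3\rangle,\qquad J(X,Y,Z)=\det(X,Y,Z).$$ The image of $\mathcal{H}$ is the set of points $(r,s,t)\in\mathbb{R}^3$ that satisfy $$|t|\le\sqrt{1+2\left(\frac{r^2-3}{6}\right)^3-3\left(\frac{r^2-3}{6}\right)^2},\qquad |s|\le r,\qquad\text{and}\qquad 0\le r\le 3.$$ The set of critical values of $\mathcal{H}$ consists of the boundary of this set, together with the line segment $\{(1,s,0): -1<s<1\}$.
   Context: $S^2\subset\mathbb{R}^3$ is the unit sphere, $\langle\cdot,\cdot\rangle$ and $|\cdot|$ are the Euclidean inner product and norm, and $e_3=(0,0,1)$. The function $H$ is smooth on $M\setminus H^{-1}(0)$, while $I$ and $J$ are smooth on $M$. A critical point of $\mathcal{H}$ is a point of $M\setminus H^{-1}(0)$ at which $dH,dI,dJ$ are linearly dependent, or a point of $H^{-1}(0)$ (the global minimum set of $H$, where $H$ is not smooth, is counted as critical). A critical value is the image under $\mathcal{H}$ of a critical point. *)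

(* Defs.v *)
From HB Require Import structures.
From mathcomp Require Import all_boot all_order all_algebra.
From mathcomp Require Import all_classical all_reals all_analysis.
Set Implicit Arguments.
Unset Strict Implicit.
Unset Printing Implicit Defensive.
Import Order.TTheory GRing.Theory Num.Theory.
Import numFieldNormedType.Exports.
Local Open Scope classical_set_scope.
Local Open Scope ring_scope.

Section Defs.
Context {R : realType}.

Notation vec3 := 'rV[R]_3.

(* The library norm on 'rV[R]_3 is the sup norm, which induces the same
   topology and differentials as the Euclidean norm [enorm] but not the same
   unit sphere. *)
Definition dot (u v : vec3) : R := \sum_(i < 3) u 0 i * v 0 i.

Definition enorm (u : vec3) : R := Num.sqrt (dot u u).

Definition e3 : vec3 := delta_mx 0 ord_max.

Definition det3 (X Y Z : vec3) : R := \det (col_mx X (col_mx Y Z)).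

Definition sphere2 : set vec3 := [set X | enorm X = 1].

Notation ambient := (vec3 * vec3 * vec3)%type.

Definition M : set ambient := sphere2 `*` sphere2 `*` sphere2.

Definition total (p : ambient) : vec3 := p.1.1 + p.1.2 + p.2.

Definition funH (p : ambient) : R := enorm (total p).

Definition funI (p : ambient) : R := dot (total p) e3.

Definition funJ (p : ambient) : R := det3 p.1.1 p.1.2 p.2.

Definition HIJ (p : ambient) : R * R * R := (funH p, funI p, funJ p).

Definition tangent_space (V : normedModType R) (S : set V) (p : V) : set V :=
  [set v | exists c : R -> V,
     [/\ forall t, S (c t), c 0 = p & is_derive (0 : R) (1 : R) c v]].

(* The differential at p of the restriction to M of a function F on the
   ambient space is the restriction of ['d F p] to the tangent space. *)
Definition dependent_differentials (p : ambient) : Prop :=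
  exists a b c : R, (a, b, c) <> (0, 0, 0) /\
    forall v, tangent_space M p v ->
      a * 'd funH p v + b * 'd funI p v + c * 'd funJ p v = 0.

Definition critical_point (p : ambient) : Prop :=
  M p /\ ((funH p <> 0 /\ dependent_differentials p) \/ funH p = 0).

Definition critical_values : set (R * R * R) :=
  HIJ @` [set p | critical_point p].

Definition boundary (T : topologicalType) (A : set T) : set T :=
  closure A `\` interior A.

End Defs.

(* Main.v *)
From HB Require Import structures.
Require Import Defs.
From mathcomp Require Import all_boot all_order all_algebra.
From mathcomp Require Import all_classical all_reals all_analysis.
From mathcomp Require Import ring lra.
Import Order.TTheory GRing.Theory Num.Theory.
Import numFieldNormedType.Exports.
Local Open Scope classical_set_scope.
Local Open Scope ring_scope.

(** Put N = X + Y + Z and let x = <Y,Z>, y = <X,Z>, z = <X,Y>.  On M everything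
    except I depends on the Gram matrix only: |N|^2 = 3 + 2(x + y + z), and
    det(X,Y,Z)^2 = 1 + 2xyz - x^2 - y^2 - z^2.

    _The image._  With a = (|N|^2 - 3)/6, the mean of x, y, z, the quantity
    1 + 2a^3 - 3a^2 is the value of J^2 at x = y = z = a.  The difference
    1 + 2a^3 - 3a^2 - J^2 is a combination of the squares of the differences of
    x, y, z whose coefficients are positive multiples of 1 + x, 1 + y, 1 + z
    and 3 + x + y + z, hence nonnegative ([sqJmax_gram]).
    Conversely, every (r,s,t) that satisfies the inequalities is reached by an
    explicit triple, built in an orthonormal frame whose first vector n has
    <n,e3> = s/r ([preimage_exists]).

    _The boundary consists of critical values._  Each face of the region is the
    place where one of 9 - H^2, H^2 - I^2, 1 + 2a^3 - 3a^2 - J^2 vanishes, and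
    each of these functions is nonnegative on all of M.  A point of M over a
    face is thus a minimum of that function on M, so its differential vanishes
    on tangent vectors ([diff_at_min]); that is a linear relation between dH,
    dI, dJ.  It is nontrivial when H is not 0, except that the third function
    gives nothing at H = 3, where the first one serves.  Points (1,s,0) come
    from (n,n,-n), where dH vanishes because N = n is orthogonal to all tangent
    vectors of the three spheres.

    _Nothing else is critical._  Let l dH + m dI + n dJ vanish on tangent
    vectors at a point where H is not 0.  Rotating the whole triple
    about N x e3 fixes H and J to first order and moves I at the rate
    H^2 - I^2, so m = 0 unless I^2 = H^2 ([stationary_funI_coef]).
    If m = 0, tangent vectors that move one or two of the three points give
    (z - y)(1 + x) = 0 and its cyclic images ([stationary_funJ_coef],
    [stationary_funH_coef]).  So either x = y = z, and J^2 takes its largest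
    value for the given H, or one of x, y, z is -1; then two of the vectors
    cancel, H = 1 and J = 0, and the value lies on the segment or on |s| = r. *)

Set Implicit Arguments.
Unset Strict Implicit.
Unset Printing Implicit Defensive.

(** * Coordinates of the dot product and the determinant *)

Section Calculus.
Context {R : realType}.
Implicit Types (u v w X Y Z : 'rV[R]_3).

Lemma dotE u v : dot u v = u 0 0 * v 0 0 + u 0 1 * v 0 1 + u 0 2 * v 0 2.
Proof.
rewrite /dot !big_ord_recl big_ord0 addr0 addrA.
by congr (_ + u _ _ * v _ _ + u _ _ * v _ _); apply/val_inj.
Qed.

(** Reading the entries off as a function of natural numbers turns the nested
    lifts of the two Laplace expansions into numerals. *)
Lemma det_mx33 (A : 'M[R]_3) : \det A =
  A 0 0 * (A 1 1 * A 2 2 - A 1 2 * A 2 1)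
  - A 0 1 * (A 1 0 * A 2 2 - A 1 2 * A 2 0)
  + A 0 2 * (A 1 0 * A 2 1 - A 1 1 * A 2 0).
Proof.
pose f i j := A (inord i) (inord j).
have E i j : A i j = f i j by rewrite /f !inord_val.
rewrite (expand_det_row _ 0) !big_ord_recl big_ord0 /cofactor.
rewrite !(expand_det_row _ 0) !big_ord_recl !big_ord0 /cofactor !det_mx11 !mxE.
rewrite !E /= /bump /= !expr0 ?expr1.
ring.
Qed.

Lemma det3E X Y Z : det3 X Y Z =
  X 0 0 * (Y 0 1 * Z 0 2 - Y 0 2 * Z 0 1)
  - X 0 1 * (Y 0 0 * Z 0 2 - Y 0 2 * Z 0 0)
  + X 0 2 * (Y 0 0 * Z 0 1 - Y 0 1 * Z 0 0).
Proof.
pose A : 'M[R]_(1 + (1 + 1), 3) := col_mx X (col_mx Y Z).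
have AX j : A 0 j = X 0 j.
  rewrite -(col_mxEu X (col_mx Y Z) 0 j) -/A.
  by congr (fun_of_matrix A _ j); apply/val_inj.
have AY j : A 1 j = Y 0 j.
  rewrite -(col_mxEu Y Z 0 j) -(col_mxEd X (col_mx Y Z)) -/A.
  by congr (fun_of_matrix A _ j); apply/val_inj.
have AZ j : A 2 j = Z 0 j.
  rewrite -(col_mxEd Y Z 0 j) -(col_mxEd X (col_mx Y Z)) -/A.
  by congr (fun_of_matrix A _ j); apply/val_inj.
rewrite /det3 -/A (det_mx33 A).
by rewrite !AX !AY !AZ.
Qed.

(** * Differentials along curves and at constrained minima *)

Lemma is_derive_comp_curve (V : normedModType R) (F : V -> R) (c : R -> V)
    (p v : V) :
  differentiable F p -> c 0 = p -> is_derive (0 : R) (1 : R) c v ->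
  is_derive (0 : R) (1 : R) (F \o c) ('d F p v).
Proof.
move=> dF c0 dc.
have diffc : differentiable c 0 by apply/derivable1_diffP; exact: ex_derive.
have dcv : 'd c 0 1 = v by rewrite -deriveE// derive_val.
have dFc : differentiable (F \o c) 0 by apply: differentiable_comp; rewrite ?c0.
apply: DeriveDef; first exact: diff_derivable.
by rewrite deriveE// diff_comp ?c0//= dcv.
Qed.

(** Fermat's rule for a global minimum.  Differentiability is assumed at the
    minimum only, since a curve that realizes a tangent vector need not be
    differentiable elsewhere. *)
Lemma is_derive_at_min (g : R -> R) d :
  is_derive (0 : R) (1 : R) g d -> (forall t, g 0 <= g t) -> d = 0.
Proof.
move=> [dg <-] gmin; set d' := 'D_1 g 0.
have: (fun h => h^-1 *: (g (h *: 1 + 0) - g 0)) @ 0^' --> d' by exact: dg.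
move=> /cvgrPdist_lt dgE; apply: contrapT => /eqP dneq0.
have /dgE : 0 < `|d'| by rewrite normr_gt0.
move=> [/= e e0 He].
(* A step against the sign of the derivative, inside the neighbourhood. *)
pose h := - Num.sg d' * (e / 2).
have hN : `|h| = e / 2.
  by rewrite normrM normrN normr_sg dneq0 mul1r ger0_norm// divr_ge0 ?ltW.
have h0 : h != 0 by rewrite -normr_gt0 hN divr_gt0.
have := He h; rewrite /= sub0r normrN hN ltr_pdivrMr// mulr_natr mulr2n ltrDl.
move=> /(_ e0 h0); rewrite addr0 /GRing.scale/= mulr1.
have : 0 <= g h - g 0 by rewrite subr_ge0.
set G := _ - _ => G0; apply/negP; rewrite -leNgt.
have [d1|d1|d1] := ltgtP d' 0; last by rewrite d1 eqxx in dneq0.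
- have h1 : 0 < h by rewrite /h ltr0_sg// opprK mul1r divr_gt0.
  have K : 0 <= h^-1 * G by rewrite mulr_ge0// invr_ge0 ltW.
  rewrite !ltr0_norm//; lra.
- have h1 : h < 0 by rewrite /h gtr0_sg// mulN1r oppr_lt0 divr_gt0.
  have K : h^-1 * G <= 0 by rewrite mulr_le0_ge0// invr_le0 ltW.
  rewrite !gtr0_norm//; lra.
Qed.

(** The first-order condition at a constrained minimum; every criticality
    statement over a face of the region is an instance. *)
Lemma diff_at_min (V : normedModType R) (S : set V) (F dF : V -> R) (p v : V) :
  is_diff p F dF -> (forall q, S q -> F p <= F q) ->
  tangent_space S p v -> dF v = 0.
Proof.
move=> [diffF <-] Fmin [c [Sc c0 dc]].
apply: is_derive_at_min (is_derive_comp_curve diffF c0 dc) _ => t /=.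
by rewrite c0; exact/Fmin/Sc.
Qed.

Lemma is_diff_linear (V W : normedModType R) (f : V -> W) p :
  linear f -> continuous f -> is_diff p f f.
Proof.
move=> lf cf.
pose fM := GRing.isLinear.Build _ _ _ _ _ lf.
pose fL : {linear _ -> _} := HB.pack f fM.
rewrite -[f]/(fL : _ -> _).
by apply: DiffDef; [exact: linear_differentiable|rewrite diff_lin].
Qed.

End Calculus.

(** * The differentials of H, I and J *)

Section Differentials.
Context {R : realType}.
Notation ambient := ('rV[R]_3 * 'rV[R]_3 * 'rV[R]_3)%type.
Local Notation total := Defs.total.
Implicit Types (u v w X Y Z : 'rV[R]_3) (p q : ambient).

Local Instance is_diff_coord1 p i :
  is_diff p (fun q => q.1.1 0 i) (fun q => q.1.1 0 i).
Proof.
apply: is_diff_linear => [a u v|q]; first by rewrite /= !mxE.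
apply: (@continuous_comp _ _ _ (fun q => q.1.1) (fun u => u 0 i)).
  by apply: (@continuous_comp _ _ _ fst fst); exact: cvg_fst.
exact: coord_continuous.
Qed.

Local Instance is_diff_coord2 p i :
  is_diff p (fun q => q.1.2 0 i) (fun q => q.1.2 0 i).
Proof.
apply: is_diff_linear => [a u v|q]; first by rewrite /= !mxE.
apply: (@continuous_comp _ _ _ (fun q => q.1.2) (fun u => u 0 i)).
  by apply: (@continuous_comp _ _ _ fst snd); [exact: cvg_fst|exact: cvg_snd].
exact: coord_continuous.
Qed.

Local Instance is_diff_coord3 p i :
  is_diff p (fun q => q.2 0 i) (fun q => q.2 0 i).
Proof.
apply: is_diff_linear => [a u v|q]; first by rewrite /= !mxE.
apply: (@continuous_comp _ _ _ snd (fun u => u 0 i)); first exact: cvg_snd.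
exact: coord_continuous.
Qed.

Local Notation C1 i := (fun q : ambient => q.1.1 0 i).
Local Notation C2 i := (fun q : ambient => q.1.2 0 i).
Local Notation C3 i := (fun q : ambient => q.2 0 i).

Definition dJ p (v : ambient) :=
  det3 v.1.1 p.1.2 p.2 + det3 p.1.1 v.1.2 p.2 + det3 p.1.1 p.1.2 v.2.

Lemma is_diff_funJ p : is_diff p funJ (dJ p).
Proof.
have -> : funJ = C1 0 * (C2 1 * C3 2 - C2 2 * C3 1)
   - C1 1 * (C2 0 * C3 2 - C2 2 * C3 0)
   + C1 2 * (C2 0 * C3 1 - C2 1 * C3 0).
  by apply/funext => q; rewrite /funJ det3E.
have minor i j := is_diffB
  (is_diffM (is_diff_coord2 p i) (is_diff_coord3 p j))
  (is_diffM (is_diff_coord2 p j) (is_diff_coord3 p i)).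
have term k i j := is_diffM (is_diff_coord1 p k) (minor i j).
apply: (is_diff_eq
  (is_diffD (is_diffB (term 0 1 2) (term 1 0 2)) (term 2 0 1))).
apply/funext => v; rewrite /dJ !det3E !fctE /GRing.scale/=; ring.
Qed.

Local Instance is_diff_dot (f df g dg : ambient -> 'rV[R]_3) p :
  (forall i, is_diff p (fun q => f q 0 i) (fun q => df q 0 i)) ->
  (forall i, is_diff p (fun q => g q 0 i) (fun q => dg q 0 i)) ->
  is_diff p (fun q => dot (f q) (g q))
    (fun v : ambient => dot (df v) (g p) + dot (f p) (dg v)).
Proof.
move=> dF dG.
pose F i q := f q 0 i; pose G i q := g q 0 i.
rewrite (_ : (fun q => _) = F 0 * G 0 + F 1 * G 1 + F 2 * G 2); last first.
  by apply/funext => q; rewrite dotE.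
have H i := is_diffM (dF i) (dG i).
apply: (is_diff_eq (is_diffD (is_diffD (H 0) (H 1)) (H 2))).
apply/funext => v; rewrite !dotE.
rewrite !fctE /GRing.scale/= /F /G.
ring.
Qed.

Local Instance is_diff_total p i :
  is_diff p (fun q => total q 0 i) (fun q => total q 0 i).
Proof.
rewrite (_ : (fun q => total q 0 i) = C1 i + C2 i + C3 i).
  exact: (is_diffD (is_diffD (is_diff_coord1 p i) (is_diff_coord2 p i))
    (is_diff_coord3 p i)).
by apply/funext => q; rewrite /total !mxE.
Qed.

(** H^2 is polynomial, so it has a differential everywhere, and H inherits one
    wherever it is nonzero. *)
Definition sqH (q : ambient) := dot (total q) (total q).

Lemma is_diff_sqH p :
  is_diff p sqH (fun v : ambient => 2 * dot (total p) (total v)).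
Proof.
apply: is_diff_eq; apply/funext => v; rewrite !dotE; ring.
Qed.

Lemma is_diff_funI p : is_diff p funI (fun v : ambient => dot (total v) e3).
Proof.
have e i : is_diff p (fun=> e3 0 i : R) (fun=> (0 : 'rV[R]_3) 0 i).
  by apply: is_diff_eq; apply/funext => v; rewrite mxE.
apply: (is_diff_eq (@is_diff_dot total total (fun=> e3) (fun=> 0) p _ e)).
apply/funext => v.
by rewrite !dotE !mxE; ring.
Qed.

Lemma sqHE q : sqH q = funH q ^+ 2.
Proof.
rewrite /funH /enorm sqr_sqrtr// dotE -!expr2 !addr_ge0 ?sqr_ge0//.
Qed.

Lemma differentiable_funH p : funH p != 0 -> differentiable funH p.
Proof.
move=> Hp; rewrite (_ : funH = Num.sqrt \o sqH)//.
have sp : 0 < sqH p by rewrite sqHE exprn_even_gt0.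
apply: differentiable_comp; first by have [] := is_diff_sqH p.
by apply/derivable1_diffP; have [] := is_derive1_sqrt sp.
Qed.

(** Multiplying dH by H removes the square root; all computations with dH below
    go through this form. *)
Lemma diff_funH p (v : ambient) : funH p != 0 ->
  funH p * 'd funH p v = dot (total p) (total v).
Proof.
move=> /differentiable_funH dH.
have := is_diff_sqH p.
rewrite (_ : sqH = funH ^+ 2); last by apply/funext => q; rewrite sqHE.
move=> dS; have := @diff_val _ _ _ _ _ _ _ dS.
rewrite diffX// => /(congr1 (fun g => g v)) E.
by apply: (@mulfI _ 2); rewrite ?pnatr_eq0// mulrA; exact: E.
Qed.

End Differentials.

(** * The inequalities that cut out the image *)

Section CriticalPoints.
Context {R : realType}.
Notation ambient := ('rV[R]_3 * 'rV[R]_3 * 'rV[R]_3)%type.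
Local Notation total := Defs.total.
Implicit Types (u v w X Y Z : 'rV[R]_3) (p q : ambient).

Lemma dot_ge0 u : 0 <= dot u u.
Proof. by rewrite dotE -!expr2 !addr_ge0 ?sqr_ge0. Qed.

Lemma sphere2P u : sphere2 u <-> dot u u = 1.
Proof.
rewrite /sphere2 /enorm /=; split=> [u1|->]; last exact: sqrtr1.
by rewrite -(sqr_sqrtr (dot_ge0 u)) u1 expr1n.
Qed.

Lemma unit_tripleP p :
  M p <-> [/\ dot p.1.1 p.1.1 = 1, dot p.1.2 p.1.2 = 1 & dot p.2 p.2 = 1].
Proof.
split=> [[[/= /sphere2P X1 /sphere2P Y1] /sphere2P Z1]|[X1 Y1 Z1]].
  by split.
by split; [split|]; apply/sphere2P.
Qed.

(** The Gram determinant. *)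
Lemma det3_sqr X Y Z : det3 X Y Z ^+ 2 =
  dot X X * dot Y Y * dot Z Z + 2 * dot Y Z * dot X Z * dot X Y
  - dot X X * dot Y Z ^+ 2 - dot Y Y * dot X Z ^+ 2 - dot Z Z * dot X Y ^+ 2.
Proof. rewrite det3E !dotE; ring. Qed.

Lemma dot_sum3 X Y Z : dot (X + Y + Z) (X + Y + Z) =
  dot X X + dot Y Y + dot Z Z + 2 * (dot Y Z + dot X Z + dot X Y).
Proof. rewrite !dotE !mxE; ring. Qed.

Lemma dot_unit_ge X Y : dot X X = 1 -> dot Y Y = 1 -> -1 <= dot X Y <= 1.
Proof.
move=> X1 Y1.
have := dot_ge0 (X + Y); have := dot_ge0 (X - Y).
have -> : dot (X - Y) (X - Y) = dot X X + dot Y Y - 2 * dot X Y.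
  by rewrite !dotE !mxE; ring.
have -> : dot (X + Y) (X + Y) = dot X X + dot Y Y + 2 * dot X Y.
  by rewrite !dotE !mxE; ring.
rewrite X1 Y1 => ? ?; apply/andP; split; lra.
Qed.

(** For 0 <= s <= 9, the largest value of J^2 on the part of M where H^2 = s. *)
Definition sqJmax (s : R) :=
  1 + 2 * ((s - 3) / 6) ^+ 3 - 3 * ((s - 3) / 6) ^+ 2.

Lemma sqJmaxE s : sqJmax s = 108^-1 * (s * (9 - s) ^+ 2).
Proof. rewrite /sqJmax; lra. Qed.

(** This identity carries both halves of the argument: its right-hand side is
    nonnegative because inner products of unit vectors are at least -1, which
    gives the bound on J, and it vanishes when x = y = z, which is how
    critical points reach the bound. *)
Lemma sqJmax_gram x y z :
  sqJmax (3 + 2 * (x + y + z)) - (1 + 2 * y * z * x - x ^+ 2 - y ^+ 2 - z ^+ 2)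
  = 2 / 9 * ((1 + x) * (y - z) ^+ 2 + (1 + y) * (x - z) ^+ 2
             + (1 + z) * (x - y) ^+ 2)
    + 1 / 27 * (3 + x + y + z) * ((y - z) ^+ 2 + (x - z) ^+ 2 + (x - y) ^+ 2).
Proof. rewrite /sqJmax; lra. Qed.

Lemma funI_coord p : funI p = total p 0 2.
Proof. rewrite /funI dotE !mxE /=; ring. Qed.

Lemma funI_sqr_le p : funI p ^+ 2 <= sqH p.
Proof.
by rewrite funI_coord /sqH dotE -!expr2 lerDr addr_ge0 ?sqr_ge0.
Qed.

Lemma sqH_M p : M p ->
  sqH p = 3 + 2 * (dot p.1.2 p.2 + dot p.1.1 p.2 + dot p.1.1 p.1.2).
Proof.
move=> /unit_tripleP[X1 Y1 Z1]; rewrite /sqH dot_sum3 X1 Y1 Z1; ring.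
Qed.

Lemma sqH_le p : M p -> sqH p <= 9.
Proof.
move=> Mp; rewrite sqH_M//; move/unit_tripleP: Mp => [X1 Y1 Z1].
have := dot_unit_ge Y1 Z1; have := dot_unit_ge X1 Z1; have := dot_unit_ge X1 Y1.
lra.
Qed.

Lemma funJ_sqr_M p : M p -> funJ p ^+ 2 =
  1 + 2 * dot p.1.1 p.2 * dot p.1.1 p.1.2 * dot p.1.2 p.2
    - dot p.1.2 p.2 ^+ 2 - dot p.1.1 p.2 ^+ 2 - dot p.1.1 p.1.2 ^+ 2.
Proof.
move=> /unit_tripleP[X1 Y1 Z1]; rewrite /funJ det3_sqr X1 Y1 Z1; ring.
Qed.

Lemma funJ_sqr_le p : M p -> funJ p ^+ 2 <= sqJmax (sqH p).
Proof.
move=> Mp; rewrite -subr_ge0 sqH_M// funJ_sqr_M// sqJmax_gram.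
move/unit_tripleP: Mp => [X1 Y1 Z1].
have := dot_unit_ge Y1 Z1; have := dot_unit_ge X1 Z1; have := dot_unit_ge X1 Y1.
move=> /andP[? _] /andP[? _] /andP[? _].
apply: addr_ge0; apply: mulr_ge0; [lra| |lra|by rewrite !addr_ge0 ?sqr_ge0].
by rewrite !addr_ge0// mulr_ge0 ?sqr_ge0//; lra.
Qed.

(** * Points over the faces are critical *)

Existing Instances is_diff_sqH is_diff_funI is_diff_funJ.

Lemma diff_funI p (v : ambient) : 'd funI p v = dot (total v) e3.
Proof. by rewrite diff_val. Qed.

Lemma diff_funJ p (v : ambient) : 'd funJ p v = dJ p v.
Proof. by rewrite diff_val. Qed.

(** Where dH vanishes on tangent vectors, dH by itself is a dependence. *)
Lemma dependent_of_diff_funH0 p : funH p != 0 ->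
  (forall v : ambient, tangent_space M p v -> dot (total p) (total v) = 0) ->
  dependent_differentials p.
Proof.
move=> H0 crit; exists 1, 0, 0.
split; first by case=> /eqP; rewrite oner_eq0.
move=> v tv; have /eqP := diff_funH v H0.
rewrite crit// mulf_eq0 (negbTE H0)/= => /eqP ->.
by rewrite mulr0 (mul0r ('d funI p v)) (mul0r ('d funJ p v)) !addr0.
Qed.

Lemma dependent_at_maxH p : M p -> sqH p = 9 -> dependent_differentials p.
Proof.
move=> Mp H9.
have D : is_diff p (- sqH) (fun v : ambient => - (2 * dot (total p) (total v))).
  exact: is_diff_eq.
have Fmin q : M q -> (- sqH) p <= (- sqH) q.
  by move=> Mq; rewrite !fctE lerN2 H9 sqH_le.
apply: dependent_of_diff_funH0 => [|v tv].
  by rewrite -sqrf_eq0 -sqHE H9 pnatr_eq0.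
have := diff_at_min D Fmin tv; lra.
Qed.

(** Minimality of H^2 - I^2 gives the relation H dH - I dI = 0. *)
Lemma dependent_at_extremal_I p : M p -> funH p != 0 -> funI p ^+ 2 = sqH p ->
  dependent_differentials p.
Proof.
move=> Mp H0 HI; exists (funH p), (- funI p), 0.
split; first by case=> /eqP; rewrite (negbTE H0).
move=> v tv.
have D : is_diff p (sqH - funI ^+ 2) (fun v : ambient =>
    2 * dot (total p) (total v) - 2 * funI p * dot (total v) e3).
  by apply: is_diff_eq; apply/funext => w; rewrite fctE /GRing.scale/= expr1.
have Fmin q : M q -> (sqH - funI ^+ 2) p <= (sqH - funI ^+ 2) q.
  by rewrite !fctE HI subrr subr_ge0 funI_sqr_le.
have := diff_at_min D Fmin tv.
rewrite mul0r addr0 (diff_funH v H0) (diff_funI p v); lra.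
Qed.

(** Minimality of sqJmax(H^2) - J^2 gives a relation between dH and dJ in which
    dJ has coefficient -J.  Away from H = 3 the bound on J is positive, so J is
    nonzero and the relation is nontrivial; at H = 3 it degenerates. *)
Lemma dependent_at_extremal_J p : M p -> funH p != 0 -> sqH p != 9 ->
  funJ p ^+ 2 = sqJmax (sqH p) -> dependent_differentials p.
Proof.
move=> Mp H0 H9 HJ.
have J0 : funJ p != 0.
  rewrite -sqrf_eq0 HJ sqJmaxE mulf_neq0 ?invr_neq0 ?pnatr_eq0// mulf_neq0//.
    by rewrite sqHE expf_neq0.
  by rewrite expf_neq0// subr_eq0 eq_sym.
(* k is the derivative of sqJmax at H^2, in the factored form of sqJmaxE. *)
pose k := 108^-1 * ((9 - sqH p) ^+ 2 - 2 * sqH p * (9 - sqH p)).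
exists (k * funH p), 0, (- funJ p).
split; first by case=> _ /eqP; rewrite oppr_eq0 (negbTE J0).
move=> v tv.
pose F := 108^-1 *: (sqH * (cst 9 - sqH) ^+ 2) - funJ ^+ 2 : ambient -> R.
have D : is_diff p F
  (fun v : ambient => k * (2 * dot (total p) (total v)) - 2 * funJ p * dJ p v).
  apply: is_diff_eq; apply/funext => w; rewrite sub0r !fctE /GRing.scale/= /k.
  by rewrite /dJ; ring.
have E q' : F q' = sqJmax (sqH q') - funJ q' ^+ 2.
  by rewrite sqJmaxE /F !fctE.
have Fmin q : M q -> F p <= F q.
  by move=> Mq; rewrite !E HJ subrr subr_ge0 funJ_sqr_le.
have := diff_at_min D Fmin tv.
rewrite mul0r addr0 -[k * funH p * _]mulrA.
rewrite (diff_funH v H0) (diff_funJ p v); lra.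
Qed.

(** Here N = n is, up to sign, each of the three vectors, and the constraint
    that a vector stays on the unit sphere makes its velocity orthogonal to it.
    The orthogonality comes from [diff_at_min] too: the squared length is
    constant on the sphere, hence minimal. *)
Lemma dependent_aligned n :
  dot n n = 1 -> dependent_differentials ((n, n, - n) : ambient).
Proof.
move=> n1; pose p : ambient := (n, n, - n).
have Np : total p = n by rewrite /Defs.total /= addrK.
apply: dependent_of_diff_funH0 => [|v tv].
  by rewrite /funH Np (sphere2P n).2// oner_neq0.
rewrite Np.
have D1 := is_diff_dot (is_diff_coord1 p) (is_diff_coord1 p).
have D2 := is_diff_dot (is_diff_coord2 p) (is_diff_coord2 p).
have D3 := is_diff_dot (is_diff_coord3 p) (is_diff_coord3 p).
have Mp : M p.
  by apply/unit_tripleP; split=> //=; rewrite -n1 !dotE !mxE; ring.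
have /unit_tripleP[p1 p2 p3] := Mp.
have C1 q : M q -> dot p.1.1 p.1.1 <= dot q.1.1 q.1.1.
  by move=> /unit_tripleP[-> _ _]; rewrite p1.
have C2 q : M q -> dot p.1.2 p.1.2 <= dot q.1.2 q.1.2.
  by move=> /unit_tripleP[_ -> _]; rewrite p2.
have C3 q : M q -> dot p.2 p.2 <= dot q.2 q.2.
  by move=> /unit_tripleP[_ _ ->]; rewrite p3.
move: (diff_at_min D1 C1 tv) (diff_at_min D2 C2 tv) (diff_at_min D3 C3 tv).
rewrite !dotE !mxE /=; lra.
Qed.

(** * Tangent vectors of M *)

Lemma tangent_space_setX (V W : normedModType R) (A : set V) (B : set W)
    (p v : V) (q w : W) :
  tangent_space A p v -> tangent_space B q w ->
  tangent_space (A `*` B) (p, q) (v, w).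
Proof.
move=> [c [cA c0 dc]] [d [dB d0 dd]]; exists (fun t => (c t, d t)).
have diffc : differentiable c 0 by apply/derivable1_diffP; exact: ex_derive.
have diffd : differentiable d 0 by apply/derivable1_diffP; exact: ex_derive.
have diffcd := differentiable_pair diffc diffd.
split=> [t|//|]; [by split; [exact: cA|exact: dB]|by rewrite c0 d0|].
apply: DeriveDef; first exact: diff_derivable.
by rewrite deriveE// diff_pair// -!deriveE// !derive_val.
Qed.

Lemma is_deriveZl (k : R -> R) dk u (x : R) :
  is_derive x (1 : R) k dk -> is_derive x (1 : R) (fun t => k t *: u) (dk *: u).
Proof.
move=> hk.
have diffk : differentiable k x by apply/derivable1_diffP; exact: ex_derive.
apply: DeriveDef; first exact/diff_derivable/differentiableZl.
rewrite deriveE ?diffZl//=; last exact: differentiableZl.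
by rewrite -deriveE// derive_val.
Qed.

(** The curve is stereographic: with q = |V|^2/4,
    ((1 - q t^2) X + t V) / (1 + q t^2) stays on the sphere and has velocity V
    at 0.  It avoids normalizing V and needs no trigonometric functions. *)
Lemma tangent_space_sphere2 X V : dot X X = 1 -> dot X V = 0 ->
  tangent_space sphere2 X V.
Proof.
move=> X1 XV; pose q := dot V V / 4.
have q0 : 0 <= q by rewrite divr_ge0 ?dot_ge0.
pose D (t : R) := (1 + q * t ^+ 2)^-1.
have D0 t : 1 + q * t ^+ 2 != 0.
  by rewrite gt_eqF// ltr_wpDr// mulr_ge0 ?sqr_ge0.
have dD : is_derive (0 : R) (1 : R) D 0.
  apply: is_derive_eq; first (apply: is_deriveV; exact: D0).
  by rewrite /= !scale0r addr0 scaler0 mulr0 scaler0.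
(* (1 - q t^2)/(1 + q t^2) is written 2 D - 1. *)
exists (fun t => (2 * D t - 1) *: X + (t * D t) *: V); split.
- move=> t; apply/sphere2P.
  have -> : dot ((2 * D t - 1) *: X + (t * D t) *: V)
     ((2 * D t - 1) *: X + (t * D t) *: V) =
     (2 * D t - 1) ^+ 2 * dot X X + 2 * (2 * D t - 1) * (t * D t) * dot X V
      + (t * D t) ^+ 2 * dot V V.
    by rewrite !dotE !mxE; ring.
  have -> : dot V V = 4 * q by rewrite /q mulrC divfK ?pnatr_eq0.
  rewrite X1 XV.
  by rewrite /D; field; exact: D0.
- rewrite /D expr0n/= mulr0 addr0 invr1 mul0r scale0r addr0 mulr1.
  by rewrite -[2]/(1 + 1) addrK scale1r.
- have da : is_derive (0 : R) (1 : R) (fun t => 2 * D t - 1) 0.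
    by apply: is_derive_eq; rewrite scaler0 subr0.
  have db : is_derive (0 : R) (1 : R) (fun t => t * D t) 1.
    apply: is_derive_eq.
    by rewrite /D expr0n/= mulr0 addr0 invr1 scale0r scale1r add0r.
  have := is_deriveD (is_deriveZl X da) (is_deriveZl V db).
  by rewrite scale0r add0r scale1r.
Qed.

Lemma tangent_space_M p (v : ambient) : M p ->
  dot p.1.1 v.1.1 = 0 -> dot p.1.2 v.1.2 = 0 -> dot p.2 v.2 = 0 ->
  tangent_space M p v.
Proof.
case: p v => [[X Y] Z] [[U V] W] /unit_tripleP[X1 Y1 Z1] /= XU YV ZW.
by do 2?[apply: tangent_space_setX]; apply: tangent_space_sphere2.
Qed.

(** * Critical points lie over the faces or over the segment *)

Lemma eq_row3 u v : u 0 0 = v 0 0 -> u 0 1 = v 0 1 -> u 0 2 = v 0 2 -> u = v.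
Proof.
move=> e0 e1 e2; apply/rowP => -[[|[|[|//]]]] lt3.
- by move: e0; congr (u _ _ = v _ _); apply/val_inj.
- by move: e1; congr (u _ _ = v _ _); apply/val_inj.
- by move: e2; congr (u _ _ = v _ _); apply/val_inj.
Qed.

Definition row3 (a b c : R) : 'rV[R]_3 := \row_i [:: a; b; c]`_i.

Definition cross u v := row3
  (u 0 1 * v 0 2 - u 0 2 * v 0 1)
  (u 0 2 * v 0 0 - u 0 0 * v 0 2)
  (u 0 0 * v 0 1 - u 0 1 * v 0 0).

Lemma row3E a b c :
  (row3 a b c 0 0 = a) * (row3 a b c 0 1 = b) * (row3 a b c 0 2 = c).
Proof. by rewrite !mxE. Qed.

Lemma cross_sum3 w X Y Z :
  cross w X + cross w Y + cross w Z = cross w (X + Y + Z).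
Proof. by apply: eq_row3; rewrite !mxE /=; ring. Qed.

Lemma dot_cross X w : dot X (cross w X) = 0.
Proof. rewrite dotE !row3E; ring. Qed.

(** The velocity v rotates the whole triple about w = N x e3.  Rotations
    preserve lengths and determinants, while N moves towards e3 with
    <w x N, e3> = |N x e3|^2 = |N|^2 - <N,e3>^2. *)
Lemma stationary_rotation p (w := cross (total p) e3)
    (v : ambient := (cross w p.1.1, cross w p.1.2, cross w p.2)) :
  [/\ dot (total p) (total v) = 0,
      dot (total v) e3 = sqH p - funI p ^+ 2 & dJ p v = 0].
Proof.
have vN : total v = cross w (total p) by exact: cross_sum3.
split; first by rewrite vN dot_cross.
  rewrite vN /sqH /funI /w; move: (total p) => N.
  rewrite !dotE !row3E /e3 !mxE /=; ring.
rewrite /dJ /v; move: w {v vN} => w; case: p => -[X Y] Z /=.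
rewrite !det3E !row3E; ring.
Qed.

Lemma dot0r u : dot u 0 = 0.
Proof. by rewrite dotE !mxE !mulr0 !addr0. Qed.

(** The relation l dH + m dI + n dJ = 0 on tangent vectors, with dH replaced by
    H dH so that the condition is linear in N, and with the tangent space given
    by its equations. *)
Definition stationary (l m n : R) p := forall v : ambient,
  dot p.1.1 v.1.1 = 0 -> dot p.1.2 v.1.2 = 0 -> dot p.2 v.2 = 0 ->
  l * dot (total p) (total v) + m * dot (total v) e3 + n * dJ p v = 0.

Lemma dependent_stationary p :
  M p -> funH p != 0 -> dependent_differentials p ->
  exists l m n, (l, m, n) <> (0, 0, 0) /\ stationary l m n p.
Proof.
move=> Mp H0 [a [b [c [abc0 abcE]]]].
exists a, (b * funH p), (c * funH p); split.
  move=> [a0 /eqP b0 /eqP c0]; apply: abc0; move: b0 c0.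
  by rewrite a0 !mulf_eq0 (negbTE H0) !orbF => /eqP -> /eqP ->.
move=> v v1 v2 v3; have := abcE _ (tangent_space_M Mp v1 v2 v3).
rewrite (diff_funI p v) (diff_funJ p v) => /(congr1 ( *%R (funH p))).
rewrite -(diff_funH v H0) mulr0 => <-; ring.
Qed.

Lemma stationary_funI_coef p l m n : stationary l m n p ->
  m * (sqH p - funI p ^+ 2) = 0.
Proof.
have [NN Ne J0] := stationary_rotation p.
set w := cross (total p) e3 in NN Ne J0.
move=> /(_ (cross w p.1.1, cross w p.1.2, cross w p.2)).
rewrite /= NN Ne J0 !mulr0 add0r addr0.
by apply; exact: dot_cross.
Qed.

(** Rotating X about Y + Z alone keeps <X, Y + Z>, hence H, but changes J at the
    rate (y - z)(1 + x); likewise for the other two vectors. *)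
Lemma stationary_funJ_coef X Y Z l n :
  dot X X = 1 -> dot Y Y = 1 -> dot Z Z = 1 ->
  stationary l 0 n (X, Y, Z) ->
  [/\ n * ((dot X Y - dot X Z) * (1 + dot Y Z)) = 0,
      n * ((dot Y Z - dot X Y) * (1 + dot X Z)) = 0 &
      n * ((dot X Z - dot Y Z) * (1 + dot X Y)) = 0].
Proof.
move=> X1 Y1 Z1 st; split.
- have := st (cross (Y + Z) X, 0, 0) (dot_cross _ _) (dot0r _) (dot0r _).
  have -> : dot (total (X, Y, Z)) (total (cross (Y + Z) X, 0, 0)) = 0.
    by rewrite dotE !mxE /=; ring.
  have -> : dJ (X, Y, Z) (cross (Y + Z) X, 0, 0) =
    (dot Y Y + dot Y Z) * dot X Z - (dot Y Z + dot Z Z) * dot X Y.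
    by rewrite /dJ/= !det3E !dotE !mxE /=; ring.
  rewrite Y1 Z1; lra.
- have := st (0, cross (X + Z) Y, 0) (dot0r _) (dot_cross _ _) (dot0r _).
  have -> : dot (total (X, Y, Z)) (total (0, cross (X + Z) Y, 0)) = 0.
    by rewrite dotE !mxE /=; ring.
  have -> : dJ (X, Y, Z) (0, cross (X + Z) Y, 0) =
    (dot X Z + dot Z Z) * dot X Y - (dot X X + dot X Z) * dot Y Z.
    by rewrite /dJ/= !det3E !dotE !mxE /=; ring.
  rewrite X1 Z1; lra.
- have := st (0, 0, cross (X + Y) Z) (dot0r _) (dot0r _) (dot_cross _ _).
  have -> : dot (total (X, Y, Z)) (total (0, 0, cross (X + Y) Z)) = 0.
    by rewrite dotE !mxE /=; ring.
  have -> : dJ (X, Y, Z) (0, 0, cross (X + Y) Z) =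
    (dot X X + dot X Y) * dot Y Z - (dot X Y + dot Y Y) * dot X Z.
    by rewrite /dJ/= !det3E !dotE !mxE /=; ring.
  rewrite X1 Y1; lra.
Qed.

(** Tilting Y towards Z and Z away from Y at the same time moves N by
    (1 + x)(Z - Y), so H^2 changes at the rate 2(1 + x)(y - z). *)
Lemma stationary_funH_coef X Y Z l :
  dot X X = 1 -> dot Y Y = 1 -> dot Z Z = 1 ->
  stationary l 0 0 (X, Y, Z) ->
  [/\ l * ((dot X Y - dot X Z) * (1 + dot Y Z)) = 0,
      l * ((dot Y Z - dot X Y) * (1 + dot X Z)) = 0 &
      l * ((dot X Z - dot Y Z) * (1 + dot X Y)) = 0].
Proof.
have orth (U V : 'rV[R]_3) : dot U U = 1 ->
    dot U (V - dot U V *: U) = 0 /\ dot U (dot V U *: U - V) = 0.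
  move=> U1; have E : dot U (V - dot U V *: U) = dot U V * (1 - dot U U).
    by rewrite !dotE !mxE; ring.
  have F : dot U (dot V U *: U - V) = dot U V * (dot U U - 1).
    by rewrite !dotE !mxE; ring.
  by rewrite E F U1 subrr mulr0.
move=> X1 Y1 Z1 st; split.
- have := st (0, Z - dot Y Z *: Y, dot Y Z *: Z - Y)
    (dot0r _) (orth _ _ Y1).1 (orth _ _ Z1).2.
  have -> : total (0, Z - dot Y Z *: Y, dot Y Z *: Z - Y) =
    (1 + dot Y Z) *: (Z - Y).
    by apply/rowP => k; rewrite !mxE; ring.
  have -> : dot (total (X, Y, Z)) ((1 + dot Y Z) *: (Z - Y)) =
    (1 + dot Y Z) * (dot X Z + dot Z Z - dot X Y - dot Y Y).
    by rewrite !dotE !mxE; ring.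
  rewrite Y1 Z1; lra.
- have := st (Z - dot X Z *: X, 0, dot X Z *: Z - X)
    (orth _ _ X1).1 (dot0r _) (orth _ _ Z1).2.
  have -> : total (Z - dot X Z *: X, 0, dot X Z *: Z - X) =
    (1 + dot X Z) *: (Z - X).
    by apply/rowP => k; rewrite !mxE; ring.
  have -> : dot (total (X, Y, Z)) ((1 + dot X Z) *: (Z - X)) =
    (1 + dot X Z) * (dot Y Z + dot Z Z - dot X Y - dot X X).
    by rewrite !dotE !mxE; ring.
  rewrite X1 Z1; lra.
- have := st (Y - dot X Y *: X, dot X Y *: Y - X, 0)
    (orth _ _ X1).1 (orth _ _ Y1).2 (dot0r _).
  have -> : total (Y - dot X Y *: X, dot X Y *: Y - X, 0) =
    (1 + dot X Y) *: (Y - X).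
    by apply/rowP => k; rewrite !mxE; ring.
  have -> : dot (total (X, Y, Z)) ((1 + dot X Y) *: (Y - X)) =
    (1 + dot X Y) * (dot Y Z + dot Y Y - dot X Z - dot X X).
    by rewrite !dotE !mxE; ring.
  rewrite X1 Y1; lra.
Qed.

Lemma gram_alternative (x y z : R) :
  (z - y) * (1 + x) = 0 -> (x - z) * (1 + y) = 0 -> (y - x) * (1 + z) = 0 ->
  [\/ x = y /\ y = z, x = -1, y = -1 | z = -1].
Proof.
move=> /eqP + /eqP + /eqP; rewrite !mulf_eq0.
move=> /orP[/eqP zy|/eqP x1]; last by constructor 2; lra.
move=> /orP[/eqP xz|/eqP y1]; last by constructor 3; lra.
by constructor 1; lra.
Qed.

(** When x = -1 the Gram determinant is -(y + z)^2; being a square, it is 0. *)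
Lemma gram_degenerate (x y z t : R) :
  t ^+ 2 = 1 + 2 * y * z * x - x ^+ 2 - y ^+ 2 - z ^+ 2 ->
  x = -1 -> t = 0 /\ y + z = 0.
Proof.
move=> + x1; rewrite x1 => E.
have E0 : t ^+ 2 + (y + z) ^+ 2 = 0 by rewrite E; ring.
move/eqP: E0; rewrite paddr_eq0 ?sqr_ge0// !sqrf_eq0 => /andP[/eqP -> /eqP ->].
by [].
Qed.

(** The three alternatives are the face I^2 = H^2, the face where J^2 is
    maximal, and the line that carries the segment. *)
Lemma dependent_cases p : M p -> funH p != 0 -> dependent_differentials p ->
  [\/ funI p ^+ 2 = sqH p, funJ p ^+ 2 = sqJmax (sqH p)
    | sqH p = 1 /\ funJ p = 0].
Proof.
move=> Mp H0 /(dependent_stationary Mp H0)[l [m [n [lmn0 st]]]].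
have [IH|IH] := eqVneq (sqH p) (funI p ^+ 2); first by constructor 1.
have m0 : m = 0.
  have /eqP := stationary_funI_coef st.
  by rewrite mulf_eq0 subr_eq0 (negbTE IH) orbF => /eqP.
have J2 := funJ_sqr_M Mp; have S2 := sqH_M Mp.
have [X1 Y1 Z1] := (unit_tripleP p).1 Mp.
move: m0 st lmn0 => -> st lmn0.
have [E1 E2 E3] : [/\
  (dot p.1.1 p.1.2 - dot p.1.1 p.2) * (1 + dot p.1.2 p.2) = 0,
  (dot p.1.2 p.2 - dot p.1.1 p.1.2) * (1 + dot p.1.1 p.2) = 0 &
  (dot p.1.1 p.2 - dot p.1.2 p.2) * (1 + dot p.1.1 p.1.2) = 0].
  move: p Mp H0 IH J2 S2 X1 Y1 Z1 st => [[X Y] Z] Mp H0 IH J2 S2 /= X1 Y1 Z1 st.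
  have [n0|n0] := eqVneq n 0; last first.
    have [F1 F2 F3] := stationary_funJ_coef X1 Y1 Z1 st.
    by split; apply: (mulfI n0); rewrite mulr0.
  have l0 : l != 0 by apply/eqP => l0; apply: lmn0; rewrite l0 n0.
  rewrite n0 in st.
  have [F1 F2 F3] := stationary_funH_coef X1 Y1 Z1 st.
  by split; apply: (mulfI l0); rewrite mulr0.
case: (gram_alternative E1 E2 E3) => [[xy yz]|x1|y1|z1].
- constructor 2; apply/esym/eqP; rewrite -subr_eq0 J2 S2; apply/eqP.
  by rewrite sqJmax_gram xy yz; ring.
- constructor 3.
  have [J0 yz0] := gram_degenerate J2 x1.
  split=> //; rewrite S2 x1; lra.
- constructor 3.
  have [|-> yz0] := @gram_degenerate _
    (dot p.1.2 p.2) (dot p.1.1 p.1.2) (funJ p) _ y1.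
    by rewrite J2; ring.
  by rewrite S2 y1; split=> //; lra.
- constructor 3.
  have [|-> yz0] := @gram_degenerate _
    (dot p.1.1 p.2) (dot p.1.2 p.2) (funJ p) _ z1.
    by rewrite J2; ring.
  by rewrite S2 z1; split=> //; lra.
Qed.

(** * Preimages *)

Lemma funH_eq p (r : R) : 0 <= r -> sqH p = r ^+ 2 -> funH p = r.
Proof.
move=> r0; rewrite /sqH /funH /enorm => ->.
by rewrite sqrtr_sqr ger0_norm.
Qed.

(** The vector with coordinates (x, y, z) in the frame n = (sg, 0, tu),
    (tu, 0, -sg), (0, 1, 0), which is orthonormal and positively oriented when
    sg^2 + tu^2 = 1.  The height of n over the plane orthogonal to e3 is tu. *)
Definition tilt (sg tu x y z : R) : 'rV[R]_3 :=
  row3 (x * sg + y * tu) z (x * tu - y * sg).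

Lemma dot_tilt sg tu x y z x' y' z' : sg ^+ 2 + tu ^+ 2 = 1 ->
  dot (tilt sg tu x y z) (tilt sg tu x' y' z') = x * x' + y * y' + z * z'.
Proof.
move=> st; rewrite dotE !row3E -[RHS]/(_ + _).
rewrite -[x * x' + y * y']mulr1 -st; ring.
Qed.

Lemma det3_tilt sg tu x1 y1 z1 x2 y2 z2 x3 y3 z3 : sg ^+ 2 + tu ^+ 2 = 1 ->
  det3 (tilt sg tu x1 y1 z1) (tilt sg tu x2 y2 z2) (tilt sg tu x3 y3 z3) =
  x1 * (y2 * z3 - z2 * y3) - y1 * (x2 * z3 - z2 * x3)
  + z1 * (x2 * y3 - y2 * x3).
Proof.
move=> st; rewrite det3E !row3E -[RHS]mulr1 -st; ring.
Qed.

Lemma tilt_sum sg tu x1 y1 z1 x2 y2 z2 x3 y3 z3 :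
  tilt sg tu x1 y1 z1 + tilt sg tu x2 y2 z2 + tilt sg tu x3 y3 z3 =
  tilt sg tu (x1 + x2 + x3) (y1 + y2 + y3) (z1 + z2 + z3).
Proof. by apply: eq_row3; rewrite !mxE /=; ring. Qed.

(** In the frame of [tilt] with tu = s/r, put h = r/3 and rho^2 = 1 - h^2.
    Placing X, Y, Z at height h over a regular triangle of radius rho gives
    N = r n and the largest determinant.  Keep Z = (h, rho, 0) and the midpoint
    (h, -rho/2, 0) of X and Y, and turn the segment from Y to X about this
    midpoint in the plane orthogonal to it: half of that segment is
    (eta rho/2, eta h, k), whose squared length must stay 3 rho^2/4.  Then N is
    unchanged and the determinant is r rho k, so k = t/(r rho), and the bound on
    t is exactly what makes eta real. *)
Lemma preimage_exists (r s t : R) : 0 <= r <= 3 -> s ^+ 2 <= r ^+ 2 ->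
  t ^+ 2 <= sqJmax (r ^+ 2) -> exists2 p, M p & HIJ p = (r, s, t).
Proof.
move=> /andP[r0 r3] sr tJ.
(* For r = 0 also s = 0, and division by zero yields tu = 0. *)
pose tu := s / r; pose sg := Num.sqrt (1 - tu ^+ 2).
have rtu : r * tu = s.
  have [req|rneq] := eqVneq r 0; last by rewrite /tu mulrC divfK.
  move: sr; rewrite req mul0r expr0n/= => s0; apply/esym/eqP.
  by rewrite -sqrf_eq0 eq_le s0 sqr_ge0.
have st1 : sg ^+ 2 + tu ^+ 2 = 1.
  rewrite sqr_sqrtr ?subrK// subr_ge0 /tu expr_div_n.
  have [->|rneq] := eqVneq r 0; first by rewrite expr0n/= invr0 mulr0.
  by rewrite ler_pdivrMr ?mul1r// exprn_even_gt0.
pose h := r / 3.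
have rh : r = 3 * h by rewrite /h; lra.
have h0 : 0 <= h by rewrite /h; lra.
have h1 : h <= 1 by rewrite /h; lra.
have h21 : h ^+ 2 <= 1 by rewrite expr_le1.
pose rho := Num.sqrt (1 - h ^+ 2).
have rho2 : rho ^+ 2 = 1 - h ^+ 2 by rewrite sqr_sqrtr// subr_ge0.
have tJ' : t ^+ 2 <= (r * rho) ^+ 2 * (3 / 4 * rho ^+ 2).
  by move: tJ; rewrite sqJmaxE exprMn !rho2 /h; lra.
(* If r rho = 0 then t = 0, and division by zero yields the wanted k = 0. *)
pose k := t / (r * rho).
have [kt k2] : r * rho * k = t /\ k ^+ 2 <= 3 / 4 * rho ^+ 2.
  rewrite /k; have [req|rneq] := eqVneq (r * rho) 0.
    move: tJ'; rewrite req invr0 !mulr0 expr0n/= !mul0r => t0.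
    split; last by rewrite mulr_ge0 ?sqr_ge0//; lra.
    by apply/esym/eqP; rewrite -sqrf_eq0 eq_le t0 sqr_ge0.
  rewrite mulrC divfK//; split=> //.
  by rewrite expr_div_n ler_pdivrMr ?exprn_even_gt0// mulrC.
pose eta := Num.sqrt ((3 / 4 * rho ^+ 2 - k ^+ 2) / (h ^+ 2 + rho ^+ 2 / 4)).
have mu0 : 0 < h ^+ 2 + rho ^+ 2 / 4 by rewrite rho2; have := sqr_ge0 h; lra.
have eta2 : eta ^+ 2 * (h ^+ 2 + rho ^+ 2 / 4) + k ^+ 2 = 3 / 4 * rho ^+ 2.
  rewrite sqr_sqrtr ?divfK ?subrK// ?gt_eqF//.
  by rewrite divr_ge0// ?subr_ge0// ltW.
exists (tilt sg tu (h + eta * rho / 2) (- rho / 2 + eta * h) k,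
        tilt sg tu (h - eta * rho / 2) (- rho / 2 - eta * h) (- k),
        tilt sg tu h rho 0).
  by apply/unit_tripleP; split; rewrite /= dot_tilt//; lra.
have N : total (tilt sg tu (h + eta * rho / 2) (- rho / 2 + eta * h) k,
        tilt sg tu (h - eta * rho / 2) (- rho / 2 - eta * h) (- k),
        tilt sg tu h rho 0) = tilt sg tu r 0 0.
  by rewrite /Defs.total/= tilt_sum; congr tilt; lra.
congr (_, _, _).
- by apply: funH_eq; rewrite // /sqH N dot_tilt//; ring.
- by rewrite funI_coord N !mxE /= mul0r subr0.
- rewrite /funJ/= det3_tilt// -kt rh; lra.
Qed.

Lemma aligned_preimage (s : R) : -1 < s < 1 ->
  exists n : 'rV[R]_3, dot n n = 1 /\ HIJ (n, n, - n) = (1, s, 0).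
Proof.
move=> /andP[s1 s2].
pose n := row3 (Num.sqrt (1 - s ^+ 2)) 0 s; exists n.
have nn : dot n n = 1.
  rewrite dotE !row3E -expr2 sqr_sqrtr; first by ring.
  by nra.
split=> //; congr (_, _, _).
- by apply: funH_eq => //; rewrite /sqH /Defs.total/= addrK nn expr1n.
- by rewrite funI_coord /Defs.total/= addrK !row3E.
- by rewrite /funJ det3E !mxE/=; ring.
Qed.

End CriticalPoints.

(** * Topology of the region *)

Section Region.
Context {R : realType}.
Notation ambient := ('rV[R]_3 * 'rV[R]_3 * 'rV[R]_3)%type.
Implicit Types (p : ambient) (q : R * R * R).

(** Squaring the inequalities makes the region an intersection of sublevel sets
    of polynomials. *)
Definition region : set (R * R * R) :=
  [set q | [/\ q.2 ^+ 2 <= sqJmax (q.1.1 ^+ 2), q.1.2 ^+ 2 <= q.1.1 ^+ 2,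
               0 <= q.1.1 & q.1.1 <= 3]].

Definition open_region : set (R * R * R) :=
  [set q | [/\ q.2 ^+ 2 < sqJmax (q.1.1 ^+ 2), q.1.2 ^+ 2 < q.1.1 ^+ 2,
               0 < q.1.1 & q.1.1 < 3]].

Lemma sqJmax_ge0 (r : R) : 0 <= sqJmax (r ^+ 2).
Proof.
rewrite sqJmaxE mulr_ge0 ?invr_ge0//.
by rewrite mulr_ge0 ?sqr_ge0.
Qed.

Lemma norm_le_sqrt (t y : R) : 0 <= y -> (`|t| <= Num.sqrt y) = (t ^+ 2 <= y).
Proof. by move=> y0; rewrite -sqrtr_sqr ler_sqrt. Qed.

Lemma regionE : region =
    [set q | let: (r, s, t) := q in
       [/\ `|t| <= Num.sqrt (1 + 2 * ((r ^+ 2 - 3) / 6) ^+ 3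
                               - 3 * ((r ^+ 2 - 3) / 6) ^+ 2),
           `|s| <= r
         & 0 <= r <= 3]].
Proof.
apply/seteqP; split=> [[[r s] t] [/= tJ sr r0 r3]|[[r s] t] [/=]].
  split; last by rewrite r0.
  - by rewrite norm_le_sqrt ?sqJmax_ge0.
  - by rewrite -(ger0_norm r0) -ler_sqr ?nnegrE// !real_normK ?num_real.
rewrite norm_le_sqrt ?sqJmax_ge0// => tJ sr /andP[r0 r3]; split => //=.
by rewrite -ler_sqr ?nnegrE// real_normK ?num_real in sr.
Qed.

Lemma continuous_r : continuous (fun q => q.1.1).
Proof.
by move=> q; apply: (@continuous_comp _ _ _ fst fst); exact: cvg_fst.
Qed.

Lemma continuous_s : continuous (fun q => q.1.2).
Proof.
move=> q; apply: (@continuous_comp _ _ _ fst snd); first exact: cvg_fst.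
exact: cvg_snd.
Qed.

Definition slackJ q := sqJmax (q.1.1 ^+ 2) - q.2 ^+ 2.
Definition slackI q := q.1.1 ^+ 2 - q.1.2 ^+ 2.

Lemma continuous_slackI : continuous slackI.
Proof.
move=> q; apply: cvgB.
- apply: (@continuous_comp _ _ _ (fun q => q.1.1) (fun x : R => x ^+ 2)).
    exact: continuous_r.
  exact: exprn_continuous.
- apply: (@continuous_comp _ _ _ (fun q => q.1.2) (fun x : R => x ^+ 2)).
    exact: continuous_s.
  exact: exprn_continuous.
Qed.

Lemma continuous_slackJ : continuous slackJ.
Proof.
move=> q; apply: cvgB.
- apply: (@continuous_comp _ _ _ (fun q => q.1.1)
    (fun x : R => sqJmax (x ^+ 2))).
    exact: continuous_r.
  rewrite /sqJmax.
  pose A : {poly R} := 6^-1 *: ('X^2 - 3%:P).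
  pose P : {poly R} := 1 + 2 *: (A ^+ 3) - 3 *: (A ^+ 2).
  rewrite (_ : (fun x => _) = horner P); first exact: continuous_horner.
  by apply/funext => x; rewrite /P /A !hornerE /=; ring.
- apply: (@continuous_comp _ _ _ snd (fun x : R => x ^+ 2)).
    exact: cvg_snd.
  exact: exprn_continuous.
Qed.

Lemma closed_region : closed region.
Proof.
have -> : region =
    (slackJ @^-1` [set x | 0 <= x]) `&` (slackI @^-1` [set x | 0 <= x])
    `&` ((fun q => q.1.1) @^-1` [set x | 0 <= x])
    `&` ((fun q => q.1.1) @^-1` [set x | x <= 3]).
  apply/seteqP; split=> q; rewrite /region/= /slackJ /slackI !subr_ge0.
    by case.
  by move=> [[[]]].
by do 3?apply: closedI; apply: closed_comp;
  rewrite ?closed_ge ?closed_le// => ? _;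
  [exact: continuous_slackJ|exact: continuous_slackI
  |exact: continuous_r|exact: continuous_r].
Qed.

Lemma open_open_region : open open_region.
Proof.
have -> : open_region =
    (slackJ @^-1` [set x | 0 < x]) `&` (slackI @^-1` [set x | 0 < x])
    `&` ((fun q => q.1.1) @^-1` [set x | 0 < x])
    `&` ((fun q => q.1.1) @^-1` [set x | x < 3]).
  apply/seteqP; split=> q; rewrite /open_region/= /slackJ /slackI !subr_gt0.
    by case.
  by move=> [[[]]].
by do 3?apply: openI; apply: open_comp;
  rewrite ?open_gt ?open_lt// => ? _;
  [exact: continuous_slackJ|exact: continuous_slackI
  |exact: continuous_r|exact: continuous_r].
Qed.

(** * Image and critical values *)

(** Two of the faces bound a square from above, and so does r <= 3 for r >= 0;
    an arbitrarily small step that increases the square leaves the region. *)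
Lemma sqr_increase (x e : R) : 0 < e ->
  exists2 x', ball x e x' & x ^+ 2 < x' ^+ 2.
Proof.
move=> e0; have e20 : 0 < e / 2 by rewrite divr_gt0.
have e2e : e / 2 < e by rewrite ltr_pdivrMr// mulr_natr mulr2n ltrDl.
have [x0|x0] := leP 0 x.
  exists (x + e / 2); last by nra.
  by rewrite /ball/= opprD addrA subrr sub0r normrN gtr0_norm.
exists (x - e / 2); last by nra.
by rewrite /ball/= opprB addrC subrK gtr0_norm.
Qed.

(** The face r = 0 does not occur separately: there s^2 <= r^2 = 0 is an
    equality. *)
Lemma boundary_regionP q : boundary region q <-> region q /\
  [\/ q.2 ^+ 2 = sqJmax (q.1.1 ^+ 2), q.1.2 ^+ 2 = q.1.1 ^+ 2 | q.1.1 = 3].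
Proof.
rewrite /boundary -(closure_id region).1; last exact: closed_region.
split=> [[Bq nIq]|[Bq eqs]].
  split=> //; have [tJ sr r0 r3] := Bq.
  have [->|neJ] := eqVneq (q.2 ^+ 2) (sqJmax (q.1.1 ^+ 2)).
    by constructor 1.
  have [->|neI] := eqVneq (q.1.2 ^+ 2) (q.1.1 ^+ 2); first by constructor 2.
  have [->|ne3] := eqVneq q.1.1 3; first by constructor 3.
  have sub : open_region `<=` (region : set (R * R * R)).
    by move=> q' [? ? ? ?]; split; exact: ltW.
  have sr' : q.1.2 ^+ 2 < q.1.1 ^+ 2 by rewrite lt_neqAle neI.
  have r0' : 0 < q.1.1.
    rewrite lt_neqAle r0 andbT; apply: contraTneq sr' => <-.
    by rewrite expr0n/= -leNgt sqr_ge0.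
  exfalso; apply: nIq; move: sub; rewrite (open_subsetE _ open_open_region).
  by apply; split; rewrite // lt_neqAle ?neJ ?ne3.
split=> // /nbhs_ballP[e /= e0 eB].
case: q Bq eqs eB => -[r s] t [/= tJ sr r0 r3] eqs eB.
have xx (x : R) : ball x e x by exact: ballxx.
case: eqs => [E|E|E].
- have [t' bt' tt'] := sqr_increase t e0.
  have [/=] := eB (r, s, t') (conj (conj (xx r) (xx s)) bt').
  by rewrite -E leNgt tt'.
- have [s' bs' ss'] := sqr_increase s e0.
  have [/= _] := eB (r, s', t) (conj (conj (xx r) bs') (xx t)).
  by rewrite -E leNgt ss'.
- have [r' br' rr'] := sqr_increase r e0.
  have [/= _ _ r'0 r'3] := eB (r', s, t) (conj (conj br' (xx s)) (xx t)).
  by move: rr'; rewrite E; nra.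
Qed.

Lemma image_HIJ : HIJ @` (M : set ambient) = region.
Proof.
apply/seteqP; split=> [_ [p Mp <-]|[[r s] t] [/= tJ sr r0 r3]].
  split; rewrite /= -?sqHE.
  - exact: funJ_sqr_le.
  - exact: funI_sqr_le.
  - exact: sqrtr_ge0.
  - have H0 : 0 <= funH p by exact: sqrtr_ge0.
    have := sqH_le Mp; rewrite sqHE; nra.
have [|p Mp pE] := preimage_exists _ sr tJ; first by rewrite r0.
by exists p.
Qed.

Lemma critical_over_face p : M p ->
  [\/ funJ p ^+ 2 = sqJmax (sqH p), funI p ^+ 2 = sqH p | sqH p = 9] ->
  critical_point p.
Proof.
move=> Mp faces; split=> //.
have [H0|H0] := eqVneq (funH p) 0; [by right|left; split; first exact/eqP].
have [H9|H9] := eqVneq (sqH p) 9; first exact: dependent_at_maxH.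
case: faces => [EJ|EI|/eqP].
- exact: dependent_at_extremal_J.
- exact: dependent_at_extremal_I.
- by rewrite (negbTE H9).
Qed.

Lemma critical_valuesE : critical_values = boundary region `|`
  [set (1, s, 0) | s in [set s : R | -1 < s < 1]].
Proof.
apply/seteqP; split=> [_ [p [Mp crit] <-]|q [|]].
- have Bp : region (HIJ p) by rewrite -image_HIJ; exists p.
  have [EI|EJ|[E1 J0]] : [\/ funI p ^+ 2 = sqH p, funJ p ^+ 2 = sqJmax (sqH p)
      | sqH p = 1 /\ funJ p = 0].
    case: crit => [[/eqP H0 dep]|H0]; first exact: dependent_cases.
    constructor 1; apply/eqP.
    by rewrite eq_le funI_sqr_le sqHE H0 expr0n/= sqr_ge0.
  + left; apply/boundary_regionP; split=> //; constructor 2.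
    by rewrite /= EI sqHE.
  + left; apply/boundary_regionP; split=> //; constructor 1.
    by rewrite /= EJ sqHE.
  + have H1 : funH p = 1 by apply: funH_eq; rewrite ?expr1n.
    have [EI|EI] := eqVneq (funI p ^+ 2) 1.
      left; apply/boundary_regionP; split=> //; constructor 2.
      by rewrite /= EI H1 expr1n.
    right; exists (funI p); last by rewrite /HIJ H1 J0.
    have I1 : funI p ^+ 2 < 1 by rewrite lt_neqAle EI -E1 funI_sqr_le.
    rewrite /=; apply/andP; split; nra.
- move=> /boundary_regionP[Bq faces].
  move: (Bq); rewrite -{1}image_HIJ => -[p Mp pE]; exists p => //.
  apply: critical_over_face => //; rewrite sqHE; move: faces; rewrite -pE /=.
  case=> [?|?|->]; [by constructor 1|by constructor 2|constructor 3; ring].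
- move=> [s /aligned_preimage[n [n1 pE]] <-]; exists (n, n, - n) => //.
  split; last first.
    left; split; last exact: dependent_aligned.
    by case: pE => -> _ _; apply/eqP; rewrite oner_eq0.
  by apply/unit_tripleP; split=> //=; rewrite -n1 !dotE !mxE; ring.
Qed.

End Region.

Unset Implicit Arguments.

Theorem theorem1p2 (R : realType) :
  let B : set (R * R * R) :=
    [set q | let: (r, s, t) := q in
       [/\ `|t| <= Num.sqrt (1 + 2 * ((r ^+ 2 - 3) / 6) ^+ 3
                               - 3 * ((r ^+ 2 - 3) / 6) ^+ 2),
           `|s| <= r
         & 0 <= r <= 3]] in
  let segment : set (R * R * R) :=
    [set (1, s, 0) | s in [set s : R | -1 < s < 1]] in
  HIJ @` M = B /\ critical_values = boundary B `|` segment.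
Proof.
by rewrite /= -regionE; split; [exact: image_HIJ|exact: critical_valuesE].
Qed.
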